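(* Let $k\ge 1$ be an integer and let $n_0,\dots,n_k$ be real numbers with $n_k\ge n_j>1$ for all $j=0,1,\dots,k-1$. Let $1<c<3/2$ and let $K:[0,\infty)\to[0,\infty)$ be nondecreasing and satisfy $$\int_1^\infty \frac{\varphi_K(s)}{s^{2c-1}}\,ds<\infty .$$ Then there exists a constant $\alpha>0$, depending only on $k$, $c$, $n_k$ and $K$, such that the following holds: if $A_0,\dots,A_{k-1}$ are analytic in $\mathbb D$ and satisfy $$\sup_{z\in\mathbb D}|A_j(z)|(1-|z|^2)^{n_k(k-j)}\le \alpha\quad (j=1,\dots,k-1),\qquad \sup_{z\in\mathbb D}|A_0(z)|(1-|z|^2)^{n_k(k-c)}\le\alpha,$$ then every solution $f$ of $$(f^{(k)})^{n_k}+A_{k-1}(z)(f^{(k-1)})^{n_{k-1}}+\cdots+A_1(z)(f')^{n_1}+A_0(z)f^{n_0}=0$$ belongs to $Q_K$.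
   Context: $\mathbb D$ is the open unit disk, $H(\mathbb D)$ the analytic functions on $\mathbb D$, $d\sigma$ area measure on $\mathbb D$ normalized so that $\sigma(\mathbb D)=1$. For $a\in\mathbb D$, $\varphi_a(z)=(a-z)/(1-\bar a z)$ and $g(a,z)=-\log|\varphi_a(z)|$. For a nondecreasing $K:[0,\infty)\to[0,\infty)$, $Q_K$ is the space of $f\in H(\mathbb D)$ with $\|f\|_{Q_K}^2=\sup_{a\in\mathbb D}\int_{\mathbb D}|f'(z)|^2K(g(a,z))\,d\sigma(z)<\infty$, and $\varphi_K(s)=\sup_{0\le t\le 1}K(st)/K(t)$ for $0<s<\infty$. A solution of the (nonlinear) equation is an analytic function $f$ on $\mathbb D$ satisfying it, where the real powers $(f^{(j)})^{n_j}$ are understood via some choice of branches, so that in particular $|(f^{(j)})^{n_j}|=|f^{(j)}|^{n_j}$. *)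

(* Defs.v *)
From Stdlib Require Import Reals List.
Open Scope R_scope.

Definition Cplx : Type := (R * R)%type.
Definition C0 : Cplx := (0, 0).
Definition C1 : Cplx := (1, 0).
Definition Cadd (z w : Cplx) : Cplx := (fst z + fst w, snd z + snd w).
Definition Copp (z : Cplx) : Cplx := (- fst z, - snd z).
Definition Csub (z w : Cplx) : Cplx := Cadd z (Copp w).
Definition Cmul (z w : Cplx) : Cplx :=
  (fst z * fst w - snd z * snd w, fst z * snd w + snd z * fst w).
Definition Cscale (r : R) (z : Cplx) : Cplx := (r * fst z, r * snd z).
Definition Cconj (z : Cplx) : Cplx := (fst z, - snd z).
Definition Cnorm (z : Cplx) : R := sqrt (fst z ^ 2 + snd z ^ 2).
Definition Cinv (z : Cplx) : Cplx :=
  (fst z / (fst z ^ 2 + snd z ^ 2), - snd z / (fst z ^ 2 + snd z ^ 2)).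
Definition Cdiv (z w : Cplx) : Cplx := Cmul z (Cinv w).
Definition Cexp (z : Cplx) : Cplx := (exp (fst z) * cos (snd z), exp (fst z) * sin (snd z)).

Definition Csum (f : nat -> Cplx) (k : nat) : Cplx :=
  fold_right (fun j acc => Cadd (f j) acc) C0 (seq 0 k).

Definition inD (z : Cplx) : Prop := Cnorm z < 1.

Definition cderiv (f : Cplx -> Cplx) (z d : Cplx) : Prop :=
  forall eps, 0 < eps -> exists delta, 0 < delta /\
    forall h, 0 < Cnorm h < delta ->
      Cnorm (Csub (Csub (f (Cadd z h)) (f z)) (Cmul h d)) <= eps * Cnorm h.

Definition analytic_D (f : Cplx -> Cplx) : Prop :=
  forall z, inD z -> exists d, cderiv f z d.

Definition deriv_chain (F : nat -> Cplx -> Cplx) : Prop :=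
  forall j z, inD z -> cderiv (F j) z (F (S j) z).

Definition rpow_branch (r : R) (w p : Cplx) : Prop :=
  (w = C0 /\ p = C0) \/ (exists L, Cexp L = w /\ p = Cexp (Cscale r L)).

Definition phi_a (a z : Cplx) : Cplx := Cdiv (Csub a z) (Csub C1 (Cmul (Cconj a) z)).
Definition green (a z : Cplx) : R := - ln (Cnorm (phi_a a z)).

(* ---------- area integral over the disk (normalised, sigma(D)=1) ----------
   For a nonnegative integrand h, "int_D h dsigma <= B" is defined through
   lower sums: for every finite family of pairwise disjoint closed
   rectangles contained in D, each with a lower bound m of h on it,
   sum m * area / pi <= B.  (Lower/inner integral; agrees with the Lebesgue
   integral for the a.e.-continuous, locally bounded integrands used here.) *)
Record Box := mkBox { bx1 : R; bx2 : R; by1 : R; by2 : R; bm : R }.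

Definition box_ok (h : Cplx -> R) (b : Box) : Prop :=
  bx1 b < bx2 b /\ by1 b < by2 b /\ 0 <= bm b /\
  inD (bx1 b, by1 b) /\ inD (bx1 b, by2 b) /\
  inD (bx2 b, by1 b) /\ inD (bx2 b, by2 b) /\
  (forall x y, bx1 b <= x <= bx2 b -> by1 b <= y <= by2 b -> bm b <= h (x, y)).

Definition boxes_disjoint (b b' : Box) : Prop :=
  bx2 b < bx1 b' \/ bx2 b' < bx1 b \/ by2 b < by1 b' \/ by2 b' < by1 b.

Definition default_box : Box := mkBox 0 0 0 0 0.

Definition boxes_ok (h : Cplx -> R) (l : list Box) : Prop :=
  (forall b, In b l -> box_ok h b) /\
  (forall i j, (i < j < length l)%nat ->
     boxes_disjoint (nth i l default_box) (nth j l default_box)).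

Definition lower_sum (l : list Box) : R :=
  fold_right (fun b acc => bm b * (bx2 b - bx1 b) * (by2 b - by1 b) / PI + acc) 0 l.

Definition area_int_le (h : Cplx -> R) (B : R) : Prop :=
  forall l, boxes_ok h l -> lower_sum l <= B.

Definition in_QK (K : R -> R) (f : Cplx -> Cplx) : Prop :=
  analytic_D f /\
  exists f' : Cplx -> Cplx, (forall z, inD z -> cderiv f z (f' z)) /\
  exists B, forall a, inD a ->
    area_int_le (fun z => Cnorm (f' z) ^ 2 * K (green a z)) B.

(* ---------- phi_K ----------
   phi_K(s) = sup_{0<=t<=1} K(st)/K(t), read as the least M >= 0 with
   K(st) <= M K(t) for all t in [0,1] (ratios a/0 with a>0 count as +oo,
   0/0 imposes no constraint).  phiK_is K s v : phi_K(s) is finite and = v. *)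
Definition phiK_bound (K : R -> R) (s M : R) : Prop :=
  0 <= M /\ forall t, 0 <= t <= 1 -> K (s * t) <= M * K t.

Definition phiK_is (K : R -> R) (s v : R) : Prop :=
  phiK_bound K s v /\ forall M, phiK_bound K s M -> v <= M.

Definition phiK_integrable (K : R -> R) (c : R) : Prop :=
  exists phi : R -> R, (forall s, 1 <= s -> phiK_is K s (phi s)) /\
  exists B, forall T, 1 <= T ->
    exists pr : Riemann_integrable (fun s => phi s / Rpower s (2 * c - 1)) 1 T,
      RiemannInt pr <= B.

(* Main.v *)
(** Taking [nk]-th roots in the equation and writing [u_j = sqrt (1 + |f^(j)|^2)],
    the hypotheses on the coefficients give, with [beta = alpha ^ (1 / nk)],
    [(1 - |z|) ^ (k - 1) |f^(k)| <= beta * (u_0 + sum_(0 < j < k) (1 - |z|) ^ (j - 1) u_j)].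
    Along a radius this is a linear differential inequality of Fuchsian type at
    the boundary: for small [beta] a weighted sum [L] of the functions on the right
    satisfies [(1 - t) L' <= L / 8], whence [|f'(z)|^8 (1 - |z|) <= M].  On the
    other hand the integrability of [phi_K] makes [K] grow at most linearly, so
    that [K (g (a, z)) ^ 2 <= C / sqrt |x - Re a|] for [z = x + i y].  The integrand
    is thus at most [C (1 / sqrt (1 - x^2 - y^2) + 1 / sqrt |x - Re a|)], whose
    integral over each horizontal chord is bounded independently of [a] and of
    the chord. *)

From Coquelicot Require Import Coquelicot.
From Stdlib Require Import Reals List Lra Lia.
Require Import Defs.
Open Scope R_scope.

(** * The modulus *)

Lemma Cnorm_ge0 (z : Cplx) : 0 <= Cnorm z.
Proof. apply sqrt_pos. Qed.

Lemma Cnorm_sqr (z : Cplx) : Cnorm z ^ 2 = fst z ^ 2 + snd z ^ 2.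
Proof. unfold Cnorm. rewrite pow2_sqrt; nra. Qed.

Lemma Cnorm_Cmul (z w : Cplx) : Cnorm (Cmul z w) = Cnorm z * Cnorm w.
Proof. exact (Cmod_mult z w). Qed.

Lemma Cnorm_triangle (z w : Cplx) : Cnorm (Cadd z w) <= Cnorm z + Cnorm w.
Proof. exact (Cmod_triangle z w). Qed.

Lemma Cnorm_C0 : Cnorm C0 = 0.
Proof. exact Cmod_0. Qed.

Lemma Cnorm_gt0 (z : Cplx) : z <> C0 -> 0 < Cnorm z.
Proof. exact (proj1 (Cmod_gt_0 z)). Qed.

Lemma Cnorm_Cscale (t : R) (z : Cplx) : 0 <= t -> Cnorm (Cscale t z) = t * Cnorm z.
Proof.
intros Ht; apply Rsqr_inj; try apply Cnorm_ge0.
- apply Rmult_le_pos; [easy | apply Cnorm_ge0].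
- generalize (Cnorm_sqr (Cscale t z)) (Cnorm_sqr z); unfold Rsqr; simpl; nra.
Qed.

Lemma Rabs_fst_le_Cnorm (z : Cplx) : Rabs (fst z) <= Cnorm z.
Proof.
apply Rsqr_incr_0_var; [| apply Cnorm_ge0].
rewrite <- Rsqr_abs; generalize (Cnorm_sqr z); unfold Rsqr; nra.
Qed.

Lemma Rabs_snd_le_Cnorm (z : Cplx) : Rabs (snd z) <= Cnorm z.
Proof.
apply Rsqr_incr_0_var; [| apply Cnorm_ge0].
rewrite <- Rsqr_abs; generalize (Cnorm_sqr z); unfold Rsqr; nra.
Qed.

Lemma inD_sqr (z : Cplx) : inD z <-> fst z ^ 2 + snd z ^ 2 < 1.
Proof.
unfold inD; rewrite <- Cnorm_sqr; generalize (Cnorm_ge0 z); split; intros; nra.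
Qed.

Lemma Cnorm_Cexp (L : Cplx) : Cnorm (Cexp L) = exp (fst L).
Proof.
apply Rsqr_inj; [apply Cnorm_ge0 | apply Rlt_le, exp_pos |].
generalize (Cnorm_sqr (Cexp L)) (sin2_cos2 (snd L)); unfold Rsqr; simpl; nra.
Qed.

Lemma rpow_branch_C0 (r : R) (p : Cplx) : rpow_branch r C0 p -> p = C0.
Proof.
intros [[_ H] | [L [H _]]]; [easy |].
generalize (exp_pos (fst L)); rewrite <- Cnorm_Cexp, H, Cnorm_C0; lra.
Qed.

Lemma rpow_branch_norm (r : R) (w p : Cplx) :
  w <> C0 -> rpow_branch r w p -> Cnorm p = Rpower (Cnorm w) r.
Proof.
intros Hw [[H _] | [L [<- ->]]]; [easy |].
rewrite !Cnorm_Cexp; unfold Rpower; rewrite ln_exp; easy.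
Qed.

(** A smoothed modulus: unlike [Cnorm] it is differentiable at zeros of the function, and being at
    least 1 it lets a smaller exponent be raised to a larger one. *)
Definition Cbracket (w : Cplx) : R := sqrt (1 + Cnorm w ^ 2).

Lemma Cbracket_ge1 (w : Cplx) : 1 <= Cbracket w.
Proof.
rewrite <- sqrt_1; apply sqrt_le_1_alt; generalize (pow2_ge_0 (Cnorm w)); lra.
Qed.

Lemma Cnorm_le_Cbracket (w : Cplx) : Cnorm w <= Cbracket w.
Proof.
rewrite <- (sqrt_pow2 (Cnorm w)) by apply Cnorm_ge0.
apply sqrt_le_1_alt; lra.
Qed.

Lemma rpow_branch_le (r s : R) (w p : Cplx) :
  0 < r <= s -> rpow_branch r w p -> Cnorm p <= Rpower (Cbracket w) s.
Proof.
intros Hr Hp.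
(* Zero is treated apart: [Rpower 0 r] is 1 because [ln 0 = 0], whereas the branch takes the value 0
   there. *)
destruct (Req_dec (Cnorm w) 0) as [H0 | H0].
- apply Cmod_eq_0 in H0; subst w; apply rpow_branch_C0 in Hp; subst p.
  rewrite Cnorm_C0; apply Rlt_le, exp_pos.
- assert (Hw : w <> C0) by (intros ->; apply H0, Cnorm_C0).
  rewrite (rpow_branch_norm r w p Hw Hp).
  apply Rle_trans with (Rpower (Cbracket w) r).
  + apply Rle_Rpower_l; [lra |]; split;
      [apply Cnorm_gt0, Hw | apply Cnorm_le_Cbracket].
  + apply Rle_Rpower; [apply Cbracket_ge1 | lra].
Qed.

Lemma Cnorm_Csum_le (f : nat -> Cplx) (m : nat) :
  Cnorm (Csum f (S m)) <= sum_f_R0 (fun j => Cnorm (f j)) m.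
Proof.
assert (H : forall l, Cnorm (fold_right (fun j acc => Cadd (f j) acc) C0 l)
   <= fold_right (fun j acc => Cnorm (f j) + acc) 0 l).
{ induction l as [| j l IH]; simpl; [rewrite Cnorm_C0; lra |].
  eapply Rle_trans; [apply Cnorm_triangle | lra]. }
assert (Hs : forall n, fold_right (fun j acc => Cnorm (f j) + acc) 0 (seq 0 (S n))
   = sum_f_R0 (fun j => Cnorm (f j)) n).
{ assert (Ha : forall l x, fold_right (fun j acc => Cnorm (f j) + acc) x l
     = fold_right (fun j acc => Cnorm (f j) + acc) 0 l + x).
  { induction l as [| j l IH]; simpl; intros x; [ring | rewrite IH; ring]. }
  induction n as [| n IH]; [simpl; ring |].
  rewrite seq_S, fold_right_app, Ha, IH; simpl; ring. }
rewrite <- Hs; apply H.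
Qed.

(** * The pointwise bound on the top derivative *)

Lemma sum_f_R0_gt0 (X : nat -> R) (m : nat) :
  (forall j, (j <= m)%nat -> 0 < X j) -> 0 < sum_f_R0 X m.
Proof.
intros HX; induction m as [| m IH]; simpl; [apply HX; lia |].
apply Rplus_lt_0_compat; [apply IH; intros; apply HX; lia | apply HX; lia].
Qed.

(** Superadditivity of the [p]-th power: write [x ^ p] as [x * x ^ (p - 1)], whose second factor
    only grows when [x] is replaced by the whole sum. *)
Lemma sum_Rpower_le (X : nat -> R) (p : R) (m : nat) :
  1 <= p -> (forall j, (j <= m)%nat -> 0 < X j) ->
  sum_f_R0 (fun j => Rpower (X j) p) m <= Rpower (sum_f_R0 X m) p.
Proof.
intros Hp HX.
assert (Hsplit : forall x, 0 < x -> Rpower x p = x * Rpower x (p - 1)).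
{ intros x Hx; rewrite <- (Rpower_1 x) at 2 by easy.
  rewrite <- Rpower_plus; f_equal; ring. }
induction m as [| m IH]; [apply Rle_refl |].
assert (Hm : 0 < X (S m)) by (apply HX; lia).
assert (Hs : 0 < sum_f_R0 X m) by (apply sum_f_R0_gt0; intros; apply HX; lia).
simpl; eapply Rle_trans.
{ apply Rplus_le_compat_r, IH; intros; apply HX; lia. }
rewrite !Hsplit, Rmult_plus_distr_r by lra.
apply Rplus_le_compat; apply Rmult_le_compat_l; try lra; apply Rle_Rpower_l; lra.
Qed.

(** Trades the real power of [s = 1 - |z| ^ 2] for an integer power of [d = 1 - |z|]: since
    [d <= s <= 1] and [w <= e], one has [s ^ w >= s ^ e >= d ^ e]. *)
Lemma coefficient_le (a s d w nk beta : R) (e : nat) :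
  0 < d -> d <= s -> s <= 1 -> 0 < nk -> 0 < beta -> w <= INR e ->
  a * Rpower s (nk * w) <= Rpower beta nk -> a <= Rpower (beta * (/ d) ^ e) nk.
Proof.
intros Hd Hds Hs Hn Hb Hw H.
assert (Hi : 0 < (/ d) ^ e) by (apply pow_lt, Rinv_0_lt_compat, Hd).
rewrite <- Rpower_mult_distr by easy.
assert (Hp := exp_pos (nk * w * ln s)); fold (Rpower s (nk * w)) in Hp.
apply Rmult_le_reg_r with (1 := Hp).
eapply Rle_trans; [exact H |].
rewrite Rmult_assoc; rewrite <- (Rmult_1_r (Rpower beta nk)) at 1.
apply Rmult_le_compat_l; [apply Rlt_le, exp_pos |].
assert (Hld : ln d <= ln s) by (apply ln_le; lra).
assert (Hls : ln s <= 0) by (rewrite <- ln_1; apply ln_le; lra).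
unfold Rpower; rewrite <- exp_plus, <- exp_0.
rewrite ln_pow, ln_Rinv by (try apply Rinv_0_lt_compat; lra).
assert (He := pos_INR e).
(* The two summands are the logarithmic forms of [d ^ e <= s ^ e] and [s ^ e <= s ^ w]. *)
assert (0 <= nk * (INR e * (ln s - ln d) + (INR e - w) * (- ln s))).
{ apply Rmult_le_pos; [lra |].
  apply Rplus_le_le_0_compat; apply Rmult_le_pos; lra. }
assert (0 <= nk * (INR e * - ln d) + nk * w * ln s) by nra.
destruct (Req_dec (nk * (INR e * - ln d) + nk * w * ln s) 0) as [-> | Hne];
  [lra |].
apply Rlt_le, exp_increasing; lra.
Qed.

(** Each term of the equation is at most an [nk]-th power [Y j ^ nk]; superadditivity gathers these
    into one [nk]-th power, and the root can be taken. *)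
Lemma top_derivative_le (m : nat) (c nk beta : R) (n : nat -> R)
    (a : nat -> Cplx) (F P : nat -> Cplx) (Pk : Cplx) (r : R) :
  0 <= r < 1 -> 1 < c -> 0 < beta ->
  (forall j, (j <= m)%nat -> 1 < n j <= nk) ->
  (forall j, (1 <= j <= m)%nat ->
     Cnorm (a j) * Rpower (1 - r ^ 2) (nk * (INR (S m) - INR j)) <= Rpower beta nk) ->
  Cnorm (a 0%nat) * Rpower (1 - r ^ 2) (nk * (INR (S m) - c)) <= Rpower beta nk ->
  (forall j, (j <= m)%nat -> rpow_branch (n j) (F j) (P j)) ->
  rpow_branch nk (F (S m)) Pk ->
  Cadd Pk (Csum (fun j => Cmul (a j) (P j)) (S m)) = C0 ->
  (1 - r) ^ m * Cnorm (F (S m))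
    <= beta * sum_f_R0 (fun j => (1 - r) ^ pred j * Cbracket (F j)) m.
Proof.
intros Hr Hc Hb Hn Ha Ha0 HP HPk Heq.
assert (Hnk : 1 < nk) by (specialize (Hn 0%nat ltac:(lia)); lra).
set (d := 1 - r); assert (Hd : 0 < d) by (unfold d; lra).
(* With [k = m + 1], the exponent [m - pred j] equals [k - j] for [j >= 1]; for [j = 0] it is
   [k - 1], which exceeds [k - c] because [c > 1]. *)
set (Y := fun j => beta * (/ d) ^ (m - pred j) * Cbracket (F j)).
assert (Hi : forall e, 0 < (/ d) ^ e)
  by (intros; apply pow_lt, Rinv_0_lt_compat, Hd).
assert (Hu : forall j, 0 < Cbracket (F j))
  by (intros j; generalize (Cbracket_ge1 (F j)); lra).
assert (HY : forall j, 0 < Y j)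
  by (intros j; unfold Y; repeat apply Rmult_lt_0_compat; easy).
assert (Hterm : forall j, (j <= m)%nat -> Cnorm (Cmul (a j) (P j)) <= Rpower (Y j) nk).
{ intros j Hj; unfold Y; rewrite Cnorm_Cmul, <- Rpower_mult_distr;
    [| apply Rmult_lt_0_compat; easy | easy].
  apply Rmult_le_compat; try apply Cnorm_ge0.
  - destruct j as [| j].
    + apply coefficient_le with (s := 1 - r ^ 2) (w := INR (S m) - c);
        try easy; unfold d; try nra.
      simpl pred; rewrite Nat.sub_0_r, S_INR; lra.
    + apply coefficient_le with (s := 1 - r ^ 2) (w := INR (S m) - INR (S j));
        try easy; unfold d; try nra; [| apply Ha; lia].
      simpl pred; rewrite minus_INR, !S_INR by lia; lra.
  - apply rpow_branch_le with (n j); [specialize (Hn j Hj); lra | apply HP, Hj]. }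
assert (Hpk : Cnorm Pk <= Rpower (sum_f_R0 Y m) nk).
{ replace (Cnorm Pk) with (Cnorm (Csum (fun j => Cmul (a j) (P j)) (S m))).
  - eapply Rle_trans; [apply Cnorm_Csum_le |].
    eapply Rle_trans; [apply sum_Rle, Hterm |].
    apply sum_Rpower_le; [lra | intros; apply HY].
  - destruct (Csum (fun j => Cmul (a j) (P j)) (S m)) as [x y], Pk as [x' y'].
    unfold Cadd, C0 in Heq; simpl in Heq; injection Heq; intros Hy Hx.
    unfold Cnorm; simpl fst; simpl snd; f_equal.
    replace x' with (- x) by lra; replace y' with (- y) by lra; ring. }
assert (HF : Cnorm (F (S m)) <= sum_f_R0 Y m).
{ assert (Hs : 0 < sum_f_R0 Y m) by (apply sum_f_R0_gt0; intros; apply HY).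
  (* The root is taken by contradiction, through strict monotonicity of [Rpower] on positive
     numbers. *)
  destruct (Rle_or_lt (Cnorm (F (S m))) (sum_f_R0 Y m)) as [H | H]; [easy |].
  assert (Hw : F (S m) <> C0) by (intros H0; rewrite H0, Cnorm_C0 in H; lra).
  rewrite (rpow_branch_norm _ _ _ Hw HPk) in Hpk.
  apply Rle_not_lt in Hpk; contradiction Hpk.
  unfold Rpower; apply exp_increasing, Rmult_lt_compat_l; [lra |].
  apply ln_increasing; lra. }
eapply Rle_trans.
{ apply Rmult_le_compat_l; [apply pow_le; lra | exact HF]. }
apply Req_le; rewrite !scal_sum; apply sum_eq; intros j Hj; unfold Y.
replace (d ^ m) with (d ^ pred j * d ^ (m - pred j))
  by (rewrite <- pow_add; f_equal; lia).
rewrite pow_inv; field; apply pow_nonzero; lra.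
Qed.

(** * Growth along a radius *)

Lemma cderiv_radial (f : Cplx -> Cplx) (zeta d : Cplx) (t : R) :
  Cnorm zeta = 1 -> cderiv f (Cscale t zeta) d ->
  is_derive (fun s => fst (f (Cscale s zeta))) t (fst (Cmul zeta d)) /\
  is_derive (fun s => snd (f (Cscale s zeta))) t (snd (Cmul zeta d)).
Proof.
intros Hz H.
assert (Hq : forall eps, 0 < eps -> exists delta : posreal, forall s, s <> 0 ->
  Rabs s < delta ->
  Cnorm (Csub (Csub (f (Cscale (t + s) zeta)) (f (Cscale t zeta)))
    (Cmul (Cscale s zeta) d)) <= eps * Rabs s).
{ intros eps He; destruct (H eps He) as [delta [Hd Hh]].
  exists (mkposreal delta Hd); intros s Hs Hsd.
  assert (Hn : Cnorm (Cscale s zeta) = Rabs s).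
  { transitivity (Cmod (Cmult (RtoC s) zeta)).
    - unfold Cmod, Cnorm; simpl; f_equal; ring.
    - rewrite Cmod_mult, Cmod_R; change (Cmod zeta) with (Cnorm zeta).
      rewrite Hz; ring. }
  replace (Cscale (t + s) zeta) with (Cadd (Cscale t zeta) (Cscale s zeta))
    by (unfold Cadd, Cscale; simpl; f_equal; ring).
  rewrite <- Hn; apply Hh; rewrite Hn; split; [apply Rabs_pos_lt |]; easy. }
(* Halving [e] turns the non-strict remainder estimate of [cderiv] into a strict one for the
   difference quotient. *)
assert (Hk : forall s x y e, s <> 0 -> 0 < e -> Rabs (x - s * y) <= e / 2 * Rabs s ->
  Rabs (x / s - y) < e).
{ intros s x y e Hs He Hx; apply Rabs_pos_lt in Hs as Hp.
  replace (x / s - y) with ((x - s * y) / s) by (field; easy).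
  unfold Rdiv; rewrite Rabs_mult, Rabs_inv.
  apply Rmult_lt_reg_r with (1 := Hp).
  rewrite Rmult_assoc, Rinv_l by lra; nra. }
split; apply is_derive_Reals; intros eps He;
  destruct (Hq (eps / 2) ltac:(lra)) as [delta Hd]; exists delta; intros s Hs Hsd;
  apply Hk; try easy; (eapply Rle_trans; [| apply (Hd s Hs Hsd)]).
- eapply Rle_trans; [| apply Rabs_fst_le_Cnorm].
  apply Req_le; f_equal; simpl; ring.
- eapply Rle_trans; [| apply Rabs_snd_le_Cnorm].
  apply Req_le; f_equal; simpl; ring.
Qed.

(** The derivative is [(x x' + y y') / u] with [u = sqrt (1 + x ^ 2 + y ^ 2)]; Cauchy-Schwarz bounds
    it by [|d|], since multiplying by the unit [zeta] preserves the modulus. *)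
Lemma Cbracket_radial_derive (f : Cplx -> Cplx) (zeta d : Cplx) (t : R) :
  Cnorm zeta = 1 -> cderiv f (Cscale t zeta) d ->
  exists l, is_derive (fun s => Cbracket (f (Cscale s zeta))) t l /\ l <= Cnorm d.
Proof.
intros Hz H; destruct (cderiv_radial f zeta d t Hz H) as [Hx Hy].
set (x := fun s => fst (f (Cscale s zeta))) in *.
set (y := fun s => snd (f (Cscale s zeta))) in *.
set (x' := fst (Cmul zeta d)) in *; set (y' := snd (Cmul zeta d)) in *.
change (is_derive x t x') in Hx; change (is_derive y t y') in Hy.
set (u := sqrt (1 + (x t ^ 2 + y t ^ 2))).
exists ((x t * x' + y t * y') / u).
assert (Hpos : 0 < 1 + (x t ^ 2 + y t ^ 2)) by nra.
assert (Hu : 0 < u) by (apply sqrt_lt_R0; easy).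
split.
- apply is_derive_ext with (fun s => sqrt (1 + (x s ^ 2 + y s ^ 2))).
  { intros s; unfold Cbracket; rewrite Cnorm_sqr; easy. }
  clearbody x y x' y'; auto_derive.
  + repeat split; try easy; [exists x' | exists y']; easy.
  + replace (Derive (fun s : R => x s) t) with x' by (symmetry; apply is_derive_unique, Hx).
    replace (Derive (fun s : R => y s) t) with y' by (symmetry; apply is_derive_unique, Hy).
    simpl; replace (x t * (x t * 1) + y t * (y t * 1)) with (x t ^ 2 + y t ^ 2) by ring.
    fold u; field; lra.
- assert (Hd : x' ^ 2 + y' ^ 2 = Cnorm d ^ 2).
  { rewrite <- (Rmult_1_l (Cnorm d)), <- Hz, <- Cnorm_Cmul, Cnorm_sqr; easy. }
  assert (Hd0 := Cnorm_ge0 d).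
  apply Rmult_le_reg_r with (1 := Hu).
  replace ((x t * x' + y t * y') / u * u) with (x t * x' + y t * y') by (field; lra).
  apply Rsqr_incr_0_var; [| nra].
  assert (Huu : u ^ 2 = 1 + (x t ^ 2 + y t ^ 2)) by (unfold u; rewrite pow2_sqrt; lra).
  unfold Rsqr.
  replace (Cnorm d * u * (Cnorm d * u)) with (Cnorm d ^ 2 * u ^ 2) by ring.
  rewrite Huu, <- Hd.
  (* This square is the defect in Cauchy-Schwarz, by Lagrange's identity. *)
  assert (0 <= (x t * y' - y t * x') ^ 2) by apply pow2_ge_0.
  nra.
Qed.

(* Weighted sum of the [U j]; the small weight of [U 0] makes the
   contribution of [U 1] to its derivative small. *)
Fixpoint lyapunov (U : nat -> R -> R) (m : nat) (t : R) : R :=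
  match m with
  | O => / 16 * U O t
  | S m' => lyapunov U m' t + (1 - t) ^ m' * U (S m') t
  end.

(* Differentiating [(1 - t) ^ j * U (j + 1)] produces the negative term
   [- j * (1 - t) ^ (j - 1) * U (j + 1)], which absorbs the derivative of the
   preceding summand, so that only the first and the last ones survive. *)
Lemma lyapunov_derive (U : nat -> R -> R) (N : nat -> R) (m : nat) (t : R) :
  0 <= t < 1 -> (forall j, 0 <= N j <= U j t) ->
  (forall j, exists l, is_derive (U j) t l /\ l <= N (S j)) ->
  exists l, is_derive (lyapunov U m) t l /\
    (1 - t) * l <= / 16 * N 1%nat + (1 - t) ^ m * N (S m).
Proof.
intros Ht HN HU; destruct (HU 0%nat) as [l0 [D0 B0]].
assert (D0' : is_derive (lyapunov U 0) t (/ 16 * l0))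
  by (apply (is_derive_scal (U 0%nat)); easy).
destruct m as [| m].
{ exists (/ 16 * l0); split; [easy |].
  generalize (HN 1%nat) (HN 2%nat); simpl; nra. }
induction m as [| m [l [Dl Bl]]].
- destruct (HU 1%nat) as [l1 [D1 B1]].
  exists (/ 16 * l0 + (0 * U 1%nat t + 1 * l1)); split.
  + apply (is_derive_plus (lyapunov U 0) (fun s => (1 - s) ^ 0 * U 1%nat s)); [easy |].
    apply (is_derive_mult (fun s => (1 - s) ^ 0) (U 1%nat)); [| easy | apply Rmult_comm].
    auto_derive; [easy | simpl; ring].
  + generalize (HN 1%nat) (HN 2%nat); simpl; nra.
- destruct (HU (S (S m))) as [l' [D' B']].
  exists (l + (- INR (S m) * (1 - t) ^ m * U (S (S m)) t + (1 - t) ^ S m * l')); split.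
  + apply (is_derive_plus (lyapunov U (S m)) (fun s => (1 - s) ^ S m * U (S (S m)) s)).
    { easy. }
    apply (is_derive_mult (fun s => (1 - s) ^ S m) (U (S (S m)))); [| easy | apply Rmult_comm].
    auto_derive; [easy |]; unfold Rminus; destruct m; simpl; ring.
  + assert (Hp : 0 <= (1 - t) ^ S m) by (apply pow_le; lra).
    generalize (HN (S (S m))) (HN (S (S (S m)))) (pos_INR m); intros H2 H3 Hm.
    assert (H4 : (1 - t) ^ S m * N (S (S m)) <= INR (S m) * ((1 - t) ^ S m * U (S (S m)) t)).
    { rewrite S_INR; apply Rle_trans with ((1 - t) ^ S m * U (S (S m)) t).
      - apply Rmult_le_compat_l; lra.
      - assert (0 <= (1 - t) ^ S m * U (S (S m)) t) by (apply Rmult_le_pos; lra).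
        nra. }
    assert (H5 : (1 - t) ^ S (S m) * l' <= (1 - t) ^ S (S m) * N (S (S (S m)))).
    { apply Rmult_le_compat_l; [apply pow_le; lra | easy]. }
    replace ((1 - t) * (l + (- INR (S m) * (1 - t) ^ m * U (S (S m)) t + (1 - t) ^ S m * l')))
      with ((1 - t) * l - INR (S m) * ((1 - t) ^ S m * U (S (S m)) t) + (1 - t) ^ S (S m) * l')
      by (simpl; ring).
    lra.
Qed.

Lemma lyapunov_ext (U V : nat -> R -> R) (m : nat) (t : R) :
  (forall j, U j t = V j t) -> lyapunov U m t = lyapunov V m t.
Proof.
intros H; induction m as [| m IH]; simpl; [rewrite H | rewrite IH, H]; easy.
Qed.

Lemma lyapunov_ge_sum (U : nat -> R -> R) (m : nat) (t : R) :
  t < 1 -> (forall j, 0 <= U j t) ->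
  / 16 * sum_f_R0 (fun j => (1 - t) ^ pred j * U j t) m <= lyapunov U m t.
Proof.
intros Ht HU; induction m as [| m IH]; simpl.
- specialize (HU 0%nat); lra.
- assert (0 <= (1 - t) ^ m * U (S m) t)
    by (apply Rmult_le_pos; [apply pow_le; lra | easy]).
  lra.
Qed.

Lemma lyapunov_ge_U1 (U : nat -> R -> R) (m : nat) (t : R) :
  t < 1 -> (forall j, 0 <= U j t) -> U 1%nat t <= lyapunov U (S m) t.
Proof.
intros Ht HU; induction m as [| m IH]; simpl in *.
- specialize (HU 0%nat); lra.
- assert (0 <= (1 - t) * (1 - t) ^ m * U (S (S m)) t)
    by (apply Rmult_le_pos; [apply (pow_le _ (S m)); lra | easy]).
  lra.
Qed.

(* The hypothesis gives [(1 - t) * L' <= (1/16 + 1/16) * L] for the Lyapunov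
   function [L], so that [L ^ 8 * (1 - t)] is nonincreasing. *)
Lemma first_derivative_growth (U N : nat -> R -> R) (m : nat) (t : R) :
  0 <= t < 1 ->
  (forall j s, 0 <= s < 1 -> 0 <= N j s <= U j s) ->
  (forall j s, 0 <= s < 1 -> exists l, is_derive (U j) s l /\ l <= N (S j) s) ->
  (forall s, 0 <= s < 1 -> (1 - s) ^ m * N (S m) s
     <= / 256 * sum_f_R0 (fun j => (1 - s) ^ pred j * U j s) m) ->
  N 1%nat t ^ 8 * (1 - t) <= lyapunov U m 0 ^ 8.
Proof.
intros Ht HN HU Hode.
assert (Hsum : forall s, 0 <= s < 1 ->
  / 16 * sum_f_R0 (fun j => (1 - s) ^ pred j * U j s) m <= lyapunov U m s).
{ intros s Hs; apply lyapunov_ge_sum; [lra |].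
  intros j; specialize (HN j s Hs); lra. }
assert (HL0 : forall s, 0 <= s < 1 -> 0 <= lyapunov U m s).
{ intros s Hs; eapply Rle_trans; [| apply Hsum, Hs].
  apply Rmult_le_pos; [lra |]; apply cond_pos_sum; intros j.
  apply Rmult_le_pos; [apply pow_le; lra | specialize (HN j s Hs); lra]. }
assert (HN1 : forall s, 0 <= s < 1 -> N 1%nat s <= lyapunov U m s).
{ intros s Hs; destruct m as [| m].
  (* For [m = 0] the function [U 1] is not a summand of [lyapunov]; the differential inequality
     itself bounds [N 1]. *)
  - specialize (Hode s Hs); specialize (HN 0%nat s Hs); simpl in *; lra.
  - eapply Rle_trans; [apply (HN 1%nat s Hs) |].
    apply lyapunov_ge_U1; [lra |]; intros j; specialize (HN j s Hs); lra. }
assert (HD : forall s, 0 <= s < 1 -> exists l, is_derive (lyapunov U m) s l /\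
  8 * (1 - s) * l <= lyapunov U m s).
{ intros s Hs.
  destruct (lyapunov_derive U (fun j => N j s) m s Hs) as [l [Dl Bl]].
  - intros j; apply HN, Hs.
  - intros j; apply HU, Hs.
  - exists l; split; [easy |].
    (* The factor [/ 256] is [/ 16 * / 16]: one [/ 16] is spent in [Hsum] to pass from the sum to
       [lyapunov], the other remains. *)
    specialize (HN1 s Hs); specialize (Hode s Hs); specialize (Hsum s Hs); lra. }
assert (HD' : forall s, 0 <= s < 1 -> exists l,
  is_derive (fun x => lyapunov U m x ^ 8 * (1 - x)) s l /\ l <= 0).
{ intros s Hs; destruct (HD s Hs) as [l [Dl Bl]].
  exists (lyapunov U m s ^ 7 * (8 * (1 - s) * l - lyapunov U m s)); split.
  - set (L := lyapunov U m) in *; clearbody L; auto_derive; [exists l; easy |].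
    replace (Derive (fun x : R => L x) s) with l by (symmetry; apply is_derive_unique, Dl).
    simpl; ring.
  - assert (0 <= lyapunov U m s ^ 7) by (apply pow_le, HL0, Hs); nra. }
destruct (MVT_gen (fun x => lyapunov U m x ^ 8 * (1 - x)) 0 t
  (Derive (fun x => lyapunov U m x ^ 8 * (1 - x)))) as [xi [Hxi Heq]].
- rewrite Rmin_left, Rmax_right by lra; intros x Hx.
  apply Derive_correct; destruct (HD' x ltac:(lra)) as [l [Dl _]]; exists l; easy.
- rewrite Rmin_left, Rmax_right by lra; intros x Hx.
  apply derivable_continuous_pt, ex_derive_Reals_0.
  destruct (HD' x ltac:(lra)) as [l [Dl _]]; exists l; easy.
- rewrite Rmin_left, Rmax_right in Hxi by lra.
  destruct (HD' xi ltac:(lra)) as [l [Dl Bl]].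
  replace (Derive (fun x : R => lyapunov U m x ^ 8 * (1 - x)) xi) with l in Heq
    by (symmetry; apply is_derive_unique, Dl).
  assert (N 1%nat t ^ 8 <= lyapunov U m t ^ 8).
  { apply pow_incr; specialize (HN 1%nat t Ht); specialize (HN1 t Ht); lra. }
  apply Rle_trans with (lyapunov U m t ^ 8 * (1 - t)); [nra |].
  set (a := lyapunov U m t ^ 8 * (1 - t)) in *.
  set (b := lyapunov U m 0 ^ 8) in *.
  nra.
Qed.

Lemma polar_form (z : Cplx) : exists zeta, Cnorm zeta = 1 /\ z = Cscale (Cnorm z) zeta.
Proof.
destruct (Req_dec (Cnorm z) 0) as [H | H].
- exists C1; split; [exact Cmod_1 |].
  rewrite H; apply Cmod_eq_0 in H; rewrite H; unfold Cscale, C1; simpl.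
  unfold RtoC; f_equal; ring.
- exists (Cscale (/ Cnorm z) z).
  assert (Hz := Cnorm_ge0 z); split.
  + rewrite Cnorm_Cscale; [field; easy | apply Rlt_le, Rinv_0_lt_compat; lra].
  + destruct z as [x y]; unfold Cscale; simpl fst; simpl snd; f_equal; field; easy.
Qed.

Lemma solution_growth (F : nat -> Cplx -> Cplx) (m : nat) :
  deriv_chain F ->
  (forall z, inD z -> (1 - Cnorm z) ^ m * Cnorm (F (S m) z)
    <= / 256 * sum_f_R0 (fun j => (1 - Cnorm z) ^ pred j * Cbracket (F j z)) m) ->
  exists M, forall z, inD z -> Cnorm (F 1%nat z) ^ 8 * (1 - Cnorm z) <= M.
Proof.
intros HF Hode.
(* All radii start at the origin, so the value of the Lyapunov function there serves every direction
   at once. *)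
exists (lyapunov (fun j _ => Cbracket (F j C0)) m 0 ^ 8); intros z Hz.
destruct (polar_form z) as [zeta [Hzeta Hpol]].
assert (Hn : forall s, 0 <= s -> Cnorm (Cscale s zeta) = s)
  by (intros s Hs; rewrite Cnorm_Cscale, Hzeta by easy; ring).
assert (Hr := Cnorm_ge0 z); unfold inD in Hz.
replace (lyapunov (fun j _ => Cbracket (F j C0)) m 0)
  with (lyapunov (fun j s => Cbracket (F j (Cscale s zeta))) m 0).
- rewrite Hpol at 1.
  apply (first_derivative_growth (fun j s => Cbracket (F j (Cscale s zeta)))
    (fun j s => Cnorm (F j (Cscale s zeta)))).
  + easy.
  + intros j s _; split; [apply Cnorm_ge0 | apply Cnorm_le_Cbracket].
  + intros j s Hs; apply Cbracket_radial_derive; [easy |].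
    apply HF; unfold inD; rewrite Hn; lra.
  + intros s Hs; specialize (Hode (Cscale s zeta)).
    unfold inD in Hode; rewrite Hn in Hode by easy; apply Hode; easy.
- apply lyapunov_ext; intros j; do 2 f_equal; unfold Cscale, C0; f_equal; ring.
Qed.

(** * Growth of the kernel *)

(* Since [phi_K] is nondecreasing, the integral of [phi_K s / s ^ (2c - 1)] over
   [T, 2T] is at least [T * phi_K T / (2T) ^ 2]. *)
Lemma kernel_linear_growth (K : R -> R) (c : R) :
  1 < c < 3 / 2 ->
  (forall x y, 0 <= x -> x <= y -> K x <= K y) ->
  (forall x, 0 <= x -> 0 <= K x) ->
  phiK_integrable K c ->
  exists B, 0 <= B /\ forall T, 1 <= T -> K T <= B * T * K 1.
Proof.
intros Hc Kmono Kpos [phi [Hphi [B HB]]].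
assert (Hmono : forall s s', 1 <= s -> s <= s' -> phi s <= phi s').
{ intros s s' Hs Hss'; destruct (Hphi s Hs) as [_ Hmin].
  destruct (Hphi s' ltac:(lra)) as [[H0 Hb] _].
  apply Hmin; split; [easy |]; intros t Ht.
  eapply Rle_trans; [| apply Hb, Ht]; apply Kmono.
  - apply Rmult_le_pos; lra.
  - apply Rmult_le_compat_r; lra. }
assert (Hpos : forall s, 1 <= s -> 0 <= phi s)
  by (intros s Hs; destruct (Hphi s Hs) as [[H _] _]; easy).
(* Here [c < 3 / 2] enters: the exponent [2 * c - 1] lies between 0 and 2. *)
assert (Hpow : forall s T, 1 <= s <= T -> 1 <= Rpower s (2 * c - 1) <= T ^ 2).
{ intros s T Hs; split.
  - apply Rle_trans with (Rpower s 0); [rewrite Rpower_O; lra | apply Rle_Rpower; lra].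
  - rewrite <- (Rpower_pow 2 T) by lra.
    apply Rle_trans with (Rpower s (INR 2)).
    + apply Rle_Rpower; simpl; lra.
    + apply Rle_Rpower_l; simpl; lra. }
assert (Hlin : forall T, 1 <= T -> phi T <= 4 * B * T).
{ intros T HT; destruct (HB (2 * T) ltac:(lra)) as [pr Hpr].
  assert (pr1 := RiemannInt_P22 pr (conj HT (ltac:(lra) : T <= 2 * T))).
  assert (pr2 := RiemannInt_P23 pr (conj HT (ltac:(lra) : T <= 2 * T))).
  assert (H1 : 0 * (T - 1) <= RiemannInt pr1 <= phi T * (T - 1)).
  { apply RiemannInt_const_bound; [easy |]; intros s Hs.
    assert (Hr := Hpow s T ltac:(lra)).
    assert (Hps := Hpos s ltac:(lra)); split.
    - apply Rdiv_le_0_compat; lra.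
    - apply Rle_div_l; [lra |]; specialize (Hmono s T ltac:(lra) ltac:(lra)); nra. }
  assert (H2 : phi T / (2 * T) ^ 2 * (2 * T - T) <= RiemannInt pr2
    <= phi (2 * T) * (2 * T - T)).
  { apply RiemannInt_const_bound; [lra |]; intros s Hs.
    assert (Hr := Hpow s (2 * T) ltac:(lra)).
    assert (Hps := Hpos T ltac:(lra)).
    assert (Hm1 := Hmono T s ltac:(lra) ltac:(lra)).
    assert (Hm2 := Hmono s (2 * T) ltac:(lra) ltac:(lra)); split.
    - apply Rmult_le_compat; try easy; [apply Rlt_le, Rinv_0_lt_compat; nra |].
      apply Rinv_le_contravar; lra.
    - apply Rle_div_l; [lra | nra]. }
  assert (H3 := RiemannInt_P26 pr1 pr2 pr).
  assert (H4 : phi T / (2 * T) ^ 2 * (2 * T - T) <= B) by lra.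
  (* The constant 4 comes from [T / (2 * T) ^ 2 = / (4 * T)]. *)
  replace (phi T) with (phi T / (2 * T) ^ 2 * (2 * T - T) * (4 * T)) by (field; lra).
  nra. }
exists (4 * B); split.
- specialize (Hlin 1 ltac:(lra)); specialize (Hpos 1 ltac:(lra)); lra.
- intros T HT; destruct (Hphi T HT) as [[_ Hb] _].
  specialize (Hb 1 ltac:(lra)); rewrite Rmult_1_r in Hb.
  specialize (Hlin T HT); specialize (Kpos 1 ltac:(lra)); nra.
Qed.

(** The lower bound is [|phi_a| < 1], from [|1 - conj(a) z|^2 - |a - z|^2 = (1 - |a|^2)(1 - |z|^2)].
    For the upper one, the denominator is at most 2 and [|a - z|] is at least the distance of the
    real parts, which leaves a singularity in [x] alone, suited to integration along horizontal
    chords. *)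
Lemma green_bounds (a z : Cplx) :
  inD a -> inD z -> fst z <> fst a ->
  0 <= green a z <= - ln (Rabs (fst z - fst a) / 2).
Proof.
intros Ha Hz Hne; apply inD_sqr in Ha, Hz.
set (N := Csub a z); set (D := Csub C1 (Cmul (Cconj a) z)).
assert (Hq : Rabs (fst z - fst a) <= Cnorm N).
{ rewrite Rabs_minus_sym; apply (Rabs_fst_le_Cnorm N). }
assert (Hq0 : 0 < Rabs (fst z - fst a)) by (apply Rabs_pos_lt; lra).
assert (HN := Cnorm_sqr N); assert (HD := Cnorm_sqr D).
assert (HN0 := Cnorm_ge0 N); assert (HD0 := Cnorm_ge0 D).
assert (Hid : Cnorm D ^ 2 - Cnorm N ^ 2
  = (1 - (fst a ^ 2 + snd a ^ 2)) * (1 - (fst z ^ 2 + snd z ^ 2))).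
{ rewrite HN, HD; simpl; ring. }
assert (Hlt : Cnorm N < Cnorm D) by nra.
assert (HD2 : Cnorm D <= 2).
{ unfold D, Csub; eapply Rle_trans; [apply Cnorm_triangle |].
  replace (Cnorm (Copp (Cmul (Cconj a) z))) with (Cnorm (Cmul (Cconj a) z))
    by (unfold Cnorm; f_equal; simpl; ring).
  rewrite Cnorm_Cmul; change (Cnorm C1) with (Cmod 1); rewrite Cmod_1.
  replace (Cnorm (Cconj a)) with (Cnorm a) by (unfold Cnorm; f_equal; simpl; ring).
  apply inD_sqr in Ha, Hz; unfold inD in *.
  generalize (Cnorm_ge0 a) (Cnorm_ge0 z); nra. }
assert (Hphi : Cnorm (phi_a a z) = Cnorm N / Cnorm D).
{ unfold phi_a, Cdiv; rewrite Cnorm_Cmul; unfold Rdiv; f_equal.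
  apply Cmod_inv; intros H0.
  assert (H1 : Cnorm D = 0) by (rewrite <- Cmod_0, <- H0; easy); lra. }
unfold green; rewrite Hphi.
assert (Hp : Rabs (fst z - fst a) / 2 <= Cnorm N / Cnorm D).
{ apply Rmult_le_compat; try lra; apply Rinv_le_contravar; lra. }
assert (Hp1 : Cnorm N / Cnorm D <= 1) by (apply Rle_div_l; lra).
split.
- assert (ln (Cnorm N / Cnorm D) <= ln 1) by (apply ln_le; lra).
  rewrite ln_1 in *; lra.
- apply Ropp_le_contravar, ln_le; lra.
Qed.

(** Apply [1 + ln x <= x] to the inverse fourth root of [r]. A fourth root is chosen so that
    squaring the kernel gives only an inverse square root, which is integrable. *)
Lemma neg_ln_le (r : R) : 0 < r -> - ln r <= / sqrt (sqrt r) * 4.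
Proof.
intros Hr; assert (Hs := sqrt_lt_R0 _ Hr); assert (Hss := sqrt_lt_R0 _ Hs).
assert (Hl : ln r = 4 * ln (sqrt (sqrt r))).
{ rewrite <- (sqrt_sqrt r) at 1 by lra; rewrite ln_mult by easy.
  rewrite <- (sqrt_sqrt (sqrt r)) at 1 2 by lra; rewrite ln_mult by easy; ring. }
assert (Hi : 0 < / sqrt (sqrt r)) by (apply Rinv_0_lt_compat, Hss).
assert (He := exp_ineq1_le (ln (/ sqrt (sqrt r)))).
rewrite exp_ln, ln_Rinv in He by easy; lra.
Qed.

Lemma kernel_green_le (K : R -> R) (B : R) :
  (forall x y, 0 <= x -> x <= y -> K x <= K y) ->
  (forall x, 0 <= x -> 0 <= K x) ->
  0 <= B -> (forall T, 1 <= T -> K T <= B * T * K 1) ->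
  exists C, 0 <= C /\ forall a z, inD a -> inD z -> fst z <> fst a ->
    K (green a z) ^ 2 <= C / sqrt (Rabs (fst z - fst a)).
Proof.
(* [E] covers both cases: [K 1] when [g <= 1], and linear growth with the factor 4 of [neg_ln_le]
   when [g > 1]. *)
intros Kmono Kpos HB HK; set (E := K 1 * (1 + 4 * B)).
assert (HK1 := Kpos 1 ltac:(lra)).
assert (HE : 0 <= E) by (apply Rmult_le_pos; lra).
exists (2 * E ^ 2); split; [nra |]; intros a z Ha Hz Hne.
assert (Hg := green_bounds a z Ha Hz Hne).
assert (Hq0 : 0 < Rabs (fst z - fst a)) by (apply Rabs_pos_lt; lra).
assert (Hq2 : Rabs (fst z - fst a) <= 2).
{ assert (H1 := Rabs_fst_le_Cnorm a); assert (H2 := Rabs_fst_le_Cnorm z).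
  unfold inD in Ha, Hz; eapply Rle_trans; [apply Rabs_triang |].
  rewrite Rabs_Ropp; lra. }
set (q := Rabs (fst z - fst a)) in *; set (g := green a z) in *.
assert (Hln := neg_ln_le (q / 2) ltac:(lra)).
set (r := sqrt (sqrt (q / 2))) in *.
assert (Hs : 0 < sqrt (q / 2)) by (apply sqrt_lt_R0; lra).
assert (Hr : 0 < r) by (apply sqrt_lt_R0, Hs).
assert (Hr1 : r <= 1).
{ unfold r; rewrite <- sqrt_1; apply sqrt_le_1_alt.
  rewrite <- sqrt_1; apply sqrt_le_1_alt; lra. }
assert (Hi : 1 <= / r) by (rewrite <- Rinv_1; apply Rinv_le_contravar; lra).
assert (HKg : K g <= E * / r).
{ destruct (Rle_or_lt g 1) as [Hg1 | Hg1].
  - apply Rle_trans with (K 1); [apply Kmono; lra |].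
    assert (0 <= K 1 * B) by nra; unfold E; nra.
  - eapply Rle_trans; [apply HK; lra |].
    assert (0 <= B * K 1) by nra.
    apply Rle_trans with (B * (/ r * 4) * K 1); [nra |].
    unfold E; nra. }
assert (Hrr : r ^ 2 = sqrt (q / 2)) by (unfold r; apply pow2_sqrt; lra).
assert (Hsq : sqrt q / 2 <= r ^ 2).
{ rewrite Hrr; replace (sqrt q / 2) with (sqrt (q / 4)).
  - apply sqrt_le_1_alt; lra.
  - rewrite sqrt_div_alt by lra; f_equal.
    replace 4 with (2 ^ 2) by ring; apply sqrt_pow2; lra. }
assert (Hsq0 := sqrt_lt_R0 _ Hq0).
apply Rle_trans with ((E * / r) ^ 2).
{ apply pow_incr; split; [apply Kpos; lra | easy]. }
replace ((E * / r) ^ 2) with (E ^ 2 * / r ^ 2) by (field; lra).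
replace (2 * E ^ 2 / sqrt q) with (E ^ 2 * / (sqrt q / 2)) by (field; lra).
apply Rmult_le_compat_l; [nra |]; apply Rinv_le_contravar; lra.
Qed.

Lemma fourth_power_le (v M d : R) :
  0 < d -> v ^ 8 * d <= M -> v ^ 4 <= sqrt M / sqrt d.
Proof.
intros Hd H; rewrite <- sqrt_div_alt by easy.
rewrite <- (sqrt_pow2 (v ^ 4)) by (replace (v ^ 4) with ((v ^ 2) ^ 2) by ring; apply pow2_ge_0).
apply sqrt_le_1_alt, (proj1 (Rle_div_r _ _ _ Hd)).
replace ((v ^ 4) ^ 2 * d) with (v ^ 8 * d) by ring; easy.
Qed.

Lemma integrand_le (K : R -> R) (c M : R) (f : Cplx -> Cplx) :
  1 < c < 3 / 2 ->
  (forall x y, 0 <= x -> x <= y -> K x <= K y) ->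
  (forall x, 0 <= x -> 0 <= K x) ->
  phiK_integrable K c ->
  (forall z, inD z -> Cnorm (f z) ^ 8 * (1 - Cnorm z) <= M) ->
  exists C, 0 <= C /\ forall a x y, inD a -> inD (x, y) -> x <> fst a ->
    Cnorm (f (x, y)) ^ 2 * K (green a (x, y))
      <= C * (/ sqrt (1 - y ^ 2 - x ^ 2) + / sqrt (Rabs (x - fst a))).
Proof.
intros Hc Kmono Kpos Hint Hf.
destruct (kernel_linear_growth K c Hc Kmono Kpos Hint) as [B [HB HK]].
destruct (kernel_green_le K B Kmono Kpos HB HK) as [E [HE Hg]].
(* The factor 2 comes from [1 - |z| ^ 2 <= 2 * (1 - |z|)]. *)
exists (sqrt (2 * M) + E); split; [generalize (sqrt_pos (2 * M)); lra |].
intros a x y Ha Hz Hne.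
specialize (Hg a (x, y) Ha Hz Hne); simpl fst in Hg.
assert (Hd : 0 < 1 - y ^ 2 - x ^ 2) by (apply inD_sqr in Hz; simpl fst in Hz; simpl snd in Hz; lra).
assert (Hv : Cnorm (f (x, y)) ^ 4 <= sqrt (2 * M) / sqrt (1 - y ^ 2 - x ^ 2)).
{ apply fourth_power_le; [easy |].
  specialize (Hf (x, y) Hz); unfold inD in Hz.
  assert (Hs := Cnorm_sqr (x, y)); simpl fst in Hs; simpl snd in Hs.
  assert (Hr := Cnorm_ge0 (x, y)).
  assert (0 <= Cnorm (f (x, y)) ^ 8) by (apply pow_le, Cnorm_ge0).
  replace (1 - y ^ 2 - x ^ 2) with ((1 - Cnorm (x, y)) * (1 + Cnorm (x, y))) by nra.
  assert (0 <= Cnorm (f (x, y)) ^ 8 * (1 - Cnorm (x, y))) by (apply Rmult_le_pos; lra).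
  nra. }
assert (Hi1 : 0 < / sqrt (1 - y ^ 2 - x ^ 2))
  by (apply Rinv_0_lt_compat, sqrt_lt_R0, Hd).
assert (Hi2 : 0 < / sqrt (Rabs (x - fst a)))
  by (apply Rinv_0_lt_compat, sqrt_lt_R0, Rabs_pos_lt; lra).
assert (Hsq := sqrt_pos (2 * M)).
unfold Rdiv in *.
set (v := Cnorm (f (x, y))) in *; set (k := K (green a (x, y))) in *.
(* This decouples the singularity at the boundary of the disk from the one on the line
   [x = fst a]. *)
assert (v ^ 2 * k <= v ^ 4 + k ^ 2) by (generalize (pow2_ge_0 (v ^ 2 - k)); nra).
nra.
Qed.

(** * Lower sums over disjoint boxes *)

Lemma increment_ge (f df : R -> R) (a b m : R) :
  a <= b ->
  (forall x, a < x < b -> is_derive f x (df x) /\ m <= df x) ->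
  (forall x, a <= x <= b -> continuity_pt f x) ->
  m * (b - a) <= f b - f a.
Proof.
intros Hab Hd Hc.
(* [Rmax m (df x)] agrees with [df x] inside and makes the end points, which
   [MVT_gen] may return, harmless. *)
destruct (MVT_gen f a b (fun x => Rmax m (df x))) as [xi [_ Heq]].
- rewrite Rmin_left, Rmax_right by easy; intros x Hx.
  destruct (Hd x Hx); rewrite Rmax_right; easy.
- rewrite Rmin_left, Rmax_right by easy; easy.
- rewrite Heq; apply Rmult_le_compat_r; [lra | apply Rmax_l].
Qed.

(* Primitive in [x] of [/ sqrt (1 - y ^ 2 - x ^ 2) + / sqrt (Rabs (x - b))];
   recall that [sqrt] vanishes on negative numbers. *)
Definition slice_primitive (b y x : R) : R :=
  atan (x / sqrt (1 - y ^ 2 - x ^ 2)) + 2 * (sqrt (x - b) - sqrt (b - x)).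

Lemma is_derive_signed_sqrt (b x : R) : x <> b ->
  is_derive (fun x => 2 * (sqrt (x - b) - sqrt (b - x))) x (/ sqrt (Rabs (x - b))).
Proof.
intros Hx; destruct (Rlt_or_le b x) as [H | H].
- apply is_derive_ext_loc with (fun x => 2 * sqrt (x - b)).
  { apply (filter_imp (fun x => b < x)); [| apply (open_gt b x H)].
    intros t Ht; rewrite (sqrt_neg_0 (b - t)); lra. }
  rewrite Rabs_right by lra.
  assert (Hs : 0 < sqrt (x - b)) by (apply sqrt_lt_R0; lra).
  auto_derive; [lra |]; replace (x + - b) with (x - b) by ring; field; lra.
- apply is_derive_ext_loc with (fun x => - 2 * sqrt (b - x)).
  { apply (filter_imp (fun x => x < b)); [| apply (open_lt b x); lra].
    intros t Ht; rewrite (sqrt_neg_0 (t - b)); lra. }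
  rewrite Rabs_left by lra; replace (- (x - b)) with (b - x) by ring.
  assert (Hs : 0 < sqrt (b - x)) by (apply sqrt_lt_R0; lra).
  auto_derive; [lra |]; replace (b + - x) with (b - x) by ring; field; lra.
Qed.

(** The function is [arcsin (x / sqrt (1 - y ^ 2))] in terms of [atan]. *)
Lemma is_derive_atan_chord (y x : R) : 0 < 1 - y ^ 2 - x ^ 2 ->
  is_derive (fun x => atan (x / sqrt (1 - y ^ 2 - x ^ 2))) x
    (/ sqrt (1 - y ^ 2 - x ^ 2)).
Proof.
intros H; assert (Hs := sqrt_lt_R0 _ H).
auto_derive.
- replace (1 - y * (y * 1) + - (x * (x * 1))) with (1 - y ^ 2 - x ^ 2) by ring.
  repeat split; lra.
- replace (1 - y * (y * 1) + - (x * (x * 1))) with (1 - y ^ 2 - x ^ 2) by ring.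
  set (s := sqrt (1 - y ^ 2 - x ^ 2)) in *.
  field; split; nra.
Qed.

Lemma is_derive_slice_primitive (b y x : R) : 0 < 1 - y ^ 2 - x ^ 2 -> x <> b ->
  is_derive (slice_primitive b y) x
    (/ sqrt (1 - y ^ 2 - x ^ 2) + / sqrt (Rabs (x - b))).
Proof.
intros H Hx.
apply (is_derive_plus (fun x => atan (x / sqrt (1 - y ^ 2 - x ^ 2)))
  (fun x => 2 * (sqrt (x - b) - sqrt (b - x)))).
- apply is_derive_atan_chord, H.
- apply is_derive_signed_sqrt, Hx.
Qed.

(** Continuity includes [x = b], where the derivative blows up; increments can thus be taken up to
    that point. *)
Lemma continuity_slice_primitive (b y x : R) : 0 < 1 - y ^ 2 - x ^ 2 ->
  continuity_pt (slice_primitive b y) x.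
Proof.
intros H; apply continuity_pt_plus.
- apply derivable_continuous_pt, ex_derive_Reals_0.
  eexists; apply is_derive_atan_chord, H.
- apply continuity_pt_filterlim.
  apply (continuous_scal_r 2 (fun x => sqrt (x - b) - sqrt (b - x))).
  apply (continuous_minus (fun x => sqrt (x - b)) (fun x => sqrt (b - x)));
    apply continuous_sqrt_comp;
    apply (continuous_minus (V := R_NormedModule));
    solve [apply continuous_id | apply continuous_const].
Qed.

Lemma chord_convex (y x1 x2 x : R) :
  0 < 1 - y ^ 2 - x1 ^ 2 -> 0 < 1 - y ^ 2 - x2 ^ 2 -> x1 <= x <= x2 ->
  0 < 1 - y ^ 2 - x ^ 2.
Proof.
intros H1 H2 Hx; destruct (Rle_or_lt 0 x).
- assert (x ^ 2 <= x2 ^ 2) by (apply pow_incr; lra); lra.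
- assert ((- x) ^ 2 <= (- x1) ^ 2) by (apply pow_incr; lra); lra.
Qed.

Lemma slice_increment_ge (b y C x1 x2 m : R) :
  x1 <= x2 -> 0 < 1 - y ^ 2 - x1 ^ 2 -> 0 < 1 - y ^ 2 - x2 ^ 2 ->
  (forall x, x1 <= x <= x2 -> x <> b ->
     m <= C * (/ sqrt (1 - y ^ 2 - x ^ 2) + / sqrt (Rabs (x - b)))) ->
  m * (x2 - x1) <= C * (slice_primitive b y x2 - slice_primitive b y x1).
Proof.
intros H12 H1 H2 Hm.
assert (Hin : forall x, x1 <= x <= x2 -> 0 < 1 - y ^ 2 - x ^ 2)
  by (intros; apply (chord_convex y x1 x2); easy).
assert (Haux : forall u v, x1 <= u -> u <= v -> v <= x2 -> (forall x, u < x < v -> x <> b) ->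
  m * (v - u) <= C * (slice_primitive b y v - slice_primitive b y u)).
{ intros u v Hu Huv Hv Hb; rewrite (Rmult_minus_distr_l C).
  apply (increment_ge (fun x => C * slice_primitive b y x)
    (fun x => C * (/ sqrt (1 - y ^ 2 - x ^ 2) + / sqrt (Rabs (x - b))))); [easy | |].
  - intros x Hx; split.
    + apply (is_derive_scal (slice_primitive b y)), is_derive_slice_primitive;
        [apply Hin; lra | apply Hb, Hx].
    + apply Hm; [lra | apply Hb, Hx].
  - intros x Hx; apply continuity_pt_scal, continuity_slice_primitive, Hin; lra. }
(* An interval with [b] in its interior is cut there and the two increments are added. *)
destruct (Rlt_or_le x1 b) as [Hb1 | Hb1]; [destruct (Rlt_or_le b x2) as [Hb2 | Hb2] |].
- assert (Hl := Haux x1 b ltac:(lra) ltac:(lra) ltac:(lra) ltac:(intros; lra)).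
  assert (Hr := Haux b x2 ltac:(lra) ltac:(lra) ltac:(lra) ltac:(intros; lra)).
  lra.
- apply Haux; try lra; intros; lra.
- apply Haux; try lra; intros; lra.
Qed.

Lemma slice_primitive_mono (b y x1 x2 : R) :
  x1 <= x2 -> 0 < 1 - y ^ 2 - x1 ^ 2 -> 0 < 1 - y ^ 2 - x2 ^ 2 ->
  slice_primitive b y x1 <= slice_primitive b y x2.
Proof.
intros H12 H1 H2.
enough (0 * (x2 - x1) <= 1 * (slice_primitive b y x2 - slice_primitive b y x1)) by lra.
apply slice_increment_ge; try easy; intros x Hx Hb.
assert (Hp := chord_convex y x1 x2 x H1 H2 Hx).
assert (0 < / sqrt (1 - y ^ 2 - x ^ 2)) by (apply Rinv_0_lt_compat, sqrt_lt_R0, Hp).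
assert (0 < / sqrt (Rabs (x - b)))
  by (apply Rinv_0_lt_compat, sqrt_lt_R0, Rabs_pos_lt; lra).
lra.
Qed.

Lemma slice_primitive_bound (b y x : R) : -1 < b < 1 -> -1 < x < 1 ->
  -8 <= slice_primitive b y x <= 8.
Proof.
intros Hb Hx; unfold slice_primitive.
assert (Hs : forall t, t <= 4 -> 0 <= sqrt t <= 2).
{ intros t Ht; split; [apply sqrt_pos |].
  rewrite <- (sqrt_pow2 2) by lra; apply sqrt_le_1_alt; lra. }
assert (H1 := Hs (x - b) ltac:(lra)); assert (H2 := Hs (b - x) ltac:(lra)).
assert (Ha := atan_bound (x / sqrt (1 - y ^ 2 - x ^ 2))).
assert (Hp := PI_4); lra.
Qed.

(** * Families of boxes and their horizontal slices *)

Definition sum_over (f : Box -> R) (l : list Box) : R :=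
  fold_right (fun b acc => f b + acc) 0 l.

Lemma sum_over_le (f g : Box -> R) (l : list Box) :
  (forall b, In b l -> f b <= g b) -> sum_over f l <= sum_over g l.
Proof.
induction l as [| b l IH]; simpl; intros H; [apply Rle_refl |].
apply Rplus_le_compat; [apply H | apply IH]; auto.
Qed.

Lemma sum_over_scal (f : Box -> R) (C : R) (l : list Box) :
  sum_over (fun b => C * f b) l = C * sum_over f l.
Proof. induction l as [| b l IH]; simpl; [| rewrite IH]; ring. Qed.

Lemma sum_over_filter (f : Box -> R) (p : Box -> bool) (l : list Box) :
  sum_over f (filter p l) = sum_over (fun b => if p b then f b else 0) l.
Proof.
induction l as [| b l IH]; simpl; [easy |].
destruct (p b); simpl; rewrite IH; [easy | ring].
Qed.

Lemma ForallOrdPairs_filter (T : Type) (r : T -> T -> Prop) (p : T -> bool) (l : list T) :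
  ForallOrdPairs r l -> ForallOrdPairs r (filter p l).
Proof.
induction 1 as [| a l Ha Hl IH]; simpl; [constructor |].
destruct (p a); [constructor |]; try easy.
apply incl_Forall with l; [apply incl_filter | easy].
Qed.

(* Induction on the length: a box splits the others into those on its left and
   those on its right. *)
Lemma disjoint_increments_le (G : R -> R) (Dom : R -> Prop) :
  (forall x x', Dom x -> Dom x' -> x <= x' -> G x <= G x') ->
  forall n l lo hi, (length l <= n)%nat -> lo <= hi ->
  ForallOrdPairs (fun b b' => bx2 b < bx1 b' \/ bx2 b' < bx1 b) l ->
  (forall b, In b l -> bx1 b <= bx2 b /\ Dom (bx1 b) /\ Dom (bx2 b) /\
     lo <= G (bx1 b) /\ G (bx2 b) <= hi) ->
  sum_over (fun b => G (bx2 b) - G (bx1 b)) l <= hi - lo.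
Proof.
intros HG; induction n as [| n IH]; intros [| b l] lo hi Hlen Hlh Hdisj Hl;
  simpl in Hlen; try lia; try (simpl; lra).
inversion Hdisj as [| ? ? Hb Hd]; subst; rewrite Forall_forall in Hb.
destruct (Hl b ltac:(left; easy)) as [Hb12 [Hb1 [Hb2 [Hblo Hbhi]]]].
assert (Hm := HG _ _ Hb1 Hb2 Hb12).
set (right := fun b' => if Rlt_dec (bx2 b) (bx1 b') then true else false).
set (f := fun b0 => G (bx2 b0) - G (bx1 b0)).
assert (Hsplit : sum_over f l
  = sum_over f (filter right l) + sum_over f (filter (fun b' => negb (right b')) l)).
{ rewrite !sum_over_filter; clear; induction l as [| b' l IH]; simpl; [ring |].
  rewrite IH; destruct (right b'); simpl; ring. }
change (f b + sum_over f l <= hi - lo); rewrite Hsplit.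
assert (Hright : sum_over f (filter right l) <= hi - G (bx2 b)).
{ apply IH; [| easy | apply ForallOrdPairs_filter, Hd |].
  - rewrite filter_length_le; lia.
  - intros b' Hin; apply filter_In in Hin; destruct Hin as [Hin Hr].
    destruct (Hl b' ltac:(right; easy)) as [H12 [H1 [H2 [H3 H4]]]].
    repeat split; try easy; apply HG; try easy.
    unfold right in Hr; destruct (Rlt_dec (bx2 b) (bx1 b')); [lra | easy]. }
assert (Hleft : sum_over f (filter (fun b' => negb (right b')) l) <= G (bx1 b) - lo).
{ apply IH; [| easy | apply ForallOrdPairs_filter, Hd |].
  - rewrite filter_length_le; lia.
  - intros b' Hin; apply filter_In in Hin; destruct Hin as [Hin Hr].
    destruct (Hl b' ltac:(right; easy)) as [H12 [H1 [H2 [H3 H4]]]].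
    repeat split; try easy; apply HG; try easy.
    unfold right in Hr; destruct (Rlt_dec (bx2 b) (bx1 b')); [easy |].
    destruct (Hb b' Hin); lra. }
unfold f at 1; lra.
Qed.

Definition meets_line (y : R) (b : Box) : bool :=
  if Rle_dec (by1 b) y then if Rle_dec y (by2 b) then true else false else false.

Lemma meets_line_spec (y : R) (b : Box) :
  meets_line y b = true <-> by1 b <= y <= by2 b.
Proof.
unfold meets_line; destruct (Rle_dec (by1 b) y), (Rle_dec y (by2 b));
  split; intros; try easy; lra.
Qed.

Lemma is_RInt_box_indicator (b : Box) (w lo hi : R) :
  lo <= by1 b <= by2 b -> by2 b <= hi ->
  is_RInt (fun y => if meets_line y b then w else 0) lo hi (w * (by2 b - by1 b)).
Proof.
intros H1 H2.
assert (Hc : forall u v t, u <= v ->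
  (forall y, u < y < v -> (if meets_line y b then w else 0) = t) ->
  is_RInt (fun y => if meets_line y b then w else 0) u v ((v - u) * t)).
{ intros u v t Huv Ht; apply is_RInt_ext with (fun _ => t).
  - rewrite Rmin_left, Rmax_right by easy; intros y Hy; symmetry; apply Ht, Hy.
  - apply (is_RInt_const (V := R_NormedModule)). }
replace (w * (by2 b - by1 b))
  with ((by1 b - lo) * 0 + ((by2 b - by1 b) * w + (hi - by2 b) * 0)) by ring.
apply (is_RInt_Chasles (V := R_NormedModule)) with (by1 b);
  [| apply (is_RInt_Chasles (V := R_NormedModule)) with (by2 b)];
  apply Hc; try lra; intros y Hy; destruct (meets_line y b) eqn:E; try easy.
- apply meets_line_spec in E; lra.
- assert (E' : meets_line y b = true) by (apply meets_line_spec; lra); congruence.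
- apply meets_line_spec in E; lra.
Qed.

(** Fubini for step functions: the left side is the integral over [y] of the sum of [w] over the
    boxes that meet the line at height [y]. *)
Lemma sum_over_slices_le (w : Box -> R) (l : list Box) (M lo hi : R) :
  lo <= hi ->
  (forall b, In b l -> lo <= by1 b <= by2 b /\ by2 b <= hi) ->
  (forall y, sum_over w (filter (meets_line y) l) <= M) ->
  sum_over (fun b => w b * (by2 b - by1 b)) l <= (hi - lo) * M.
Proof.
intros Hlh Hl HM.
apply (is_RInt_le (fun y => sum_over (fun b => if meets_line y b then w b else 0) l)
  (fun _ => M) lo hi); [easy | | apply (is_RInt_const (V := R_NormedModule)) |].
- clear HM; induction l as [| b l IH]; simpl.
  + evar_last; [apply (is_RInt_const (V := R_NormedModule)) | apply Rmult_0_r].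
  + apply (is_RInt_plus (V := R_NormedModule)).
    * apply is_RInt_box_indicator; apply Hl; left; easy.
    * apply IH; intros b' Hb'; apply Hl; right; easy.
- intros y _; rewrite <- sum_over_filter; apply HM.
Qed.

Lemma ForallOrdPairs_nth (T : Type) (r : T -> T -> Prop) (d : T) (l : list T) :
  (forall i j, (i < j < length l)%nat -> r (nth i l d) (nth j l d)) ->
  ForallOrdPairs r l.
Proof.
induction l as [| a l IH]; intros H; constructor.
- apply Forall_nth; intros j d' Hj; rewrite (nth_indep l d' d Hj).
  apply (H 0%nat (S j)); simpl; lia.
- apply IH; intros i j Hij; apply (H (S i) (S j)); simpl; lia.
Qed.

(** Each squared coordinate is at most that of one end point, so some corner is at least as far from
    the origin. *)
Lemma box_in_disk (h : Cplx -> R) (b : Box) (x y : R) :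
  box_ok h b -> bx1 b <= x <= bx2 b -> by1 b <= y <= by2 b -> x ^ 2 + y ^ 2 < 1.
Proof.
intros [_ [_ [_ [H11 [H12 [H21 [H22 _]]]]]]] Hx Hy.
apply inD_sqr in H11, H12, H21, H22; simpl fst in *; simpl snd in *.
assert (x ^ 2 <= bx1 b ^ 2 \/ x ^ 2 <= bx2 b ^ 2).
{ destruct (Rle_or_lt 0 x); [right | left]; nra. }
assert (y ^ 2 <= by1 b ^ 2 \/ y ^ 2 <= by2 b ^ 2).
{ destruct (Rle_or_lt 0 y); [right | left]; nra. }
lra.
Qed.

(** On each horizontal line the boxes cut out disjoint intervals, whose contributions are dominated
    by increments of [slice_primitive]. These total at most its oscillation 16, and the heights
    range over an interval of length 2, whence 32. *)
Lemma area_int_le_of_bound (h : Cplx -> R) (b C : R) :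
  -1 < b < 1 -> 0 <= C ->
  (forall x y, inD (x, y) -> x <> b ->
     h (x, y) <= C * (/ sqrt (1 - y ^ 2 - x ^ 2) + / sqrt (Rabs (x - b)))) ->
  area_int_le h (32 * C / PI).
Proof.
intros Hb HC Hh l [Hok Hdisj].
apply ForallOrdPairs_nth in Hdisj.
set (w := fun bx => bm bx * (bx2 bx - bx1 bx)).
assert (Hsl : forall y, sum_over w (filter (meets_line y) l) <= C * 16).
{ intros y; set (ly := filter (meets_line y) l).
  assert (Hly : forall bx, In bx ly -> box_ok h bx /\ by1 bx <= y <= by2 bx).
  { intros bx Hin; apply filter_In in Hin; rewrite meets_line_spec in Hin.
    split; [apply Hok |]; easy. }
  assert (Hin : forall bx x, In bx ly -> bx1 bx <= x <= bx2 bx -> 0 < 1 - y ^ 2 - x ^ 2).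
  { intros bx x H Hx; destruct (Hly bx H) as [Hbok Hy].
    generalize (box_in_disk h bx x y Hbok Hx Hy); lra. }
  apply Rle_trans with
    (sum_over (fun bx => C * (slice_primitive b y (bx2 bx) - slice_primitive b y (bx1 bx))) ly).
  - apply sum_over_le; intros bx H; destruct (Hly bx H) as [Hbok Hy].
    assert (Hx12 : bx1 bx < bx2 bx) by (destruct Hbok; easy).
    apply slice_increment_ge; [lra | apply (Hin bx); [easy | lra].. |].
    intros x Hx Hne; eapply Rle_trans; [apply Hbok; eassumption |].
    apply Hh; [| easy]; apply inD_sqr; simpl fst; simpl snd.
    generalize (Hin bx x H Hx); lra.
  - rewrite sum_over_scal; apply Rmult_le_compat_l; [easy |].
    replace 16 with (8 - - (8)) by ring.
    apply (disjoint_increments_le (slice_primitive b y) (fun x => 0 < 1 - y ^ 2 - x ^ 2))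
      with (length ly); [| easy | lra | |].
    + intros; apply slice_primitive_mono; easy.
    (* Boxes that meet a common horizontal line cannot be separated vertically, so disjointness
       separates them horizontally. *)
    + assert (Hd := ForallOrdPairs_filter _ _ (meets_line y) _ Hdisj); fold ly in Hd.
      clear -Hd Hly; induction Hd as [| bx l' Hbx Hd IH]; constructor.
      * apply Forall_forall; intros bx' H'; rewrite Forall_forall in Hbx.
        destruct (Hly bx ltac:(left; easy)) as [_ H1].
        destruct (Hly bx' ltac:(right; easy)) as [_ H2].
        destruct (Hbx bx' H') as [H | [H | [H | H]]]; auto; lra.
      * apply IH; intros bx' H'; apply Hly; right; easy.
    + intros bx H; destruct (Hly bx H) as [Hbok Hy].
      assert (Hx12 : bx1 bx < bx2 bx) by (destruct Hbok; easy).
      assert (H1 := Hin bx (bx1 bx) H ltac:(lra)).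
      assert (H2 := Hin bx (bx2 bx) H ltac:(lra)).
      assert (Hy2 := pow2_ge_0 y).
      repeat split; try easy; try lra; apply slice_primitive_bound; try easy; nra. }
assert (Hsum : sum_over (fun bx => w bx * (by2 bx - by1 bx)) l <= (1 - -1) * (C * 16)).
{ apply sum_over_slices_le; [lra | | easy].
  intros bx H; specialize (Hok bx H).
  assert (Hx12 : bx1 bx < bx2 bx) by (destruct Hok; easy).
  assert (Hy12 : by1 bx < by2 bx) by (destruct Hok as [_ [? _]]; easy).
  assert (H1 := box_in_disk h bx (bx1 bx) (by1 bx) Hok ltac:(lra) ltac:(lra)).
  assert (H2 := box_in_disk h bx (bx1 bx) (by2 bx) Hok ltac:(lra) ltac:(lra)).
  assert (Hx2 := pow2_ge_0 (bx1 bx)).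
  repeat split; nra. }
assert (Hlow : lower_sum l = / PI * sum_over (fun bx => w bx * (by2 bx - by1 bx)) l).
{ rewrite <- sum_over_scal; unfold lower_sum, w.
  clear; induction l as [| bx l IH]; simpl; [easy |].
  rewrite IH; unfold Rdiv; ring. }
rewrite Hlow; assert (Hpi : 0 < / PI) by (apply Rinv_0_lt_compat, PI_RGT_0).
unfold Rdiv; nra.
Qed.

(** * Membership in the space [Q_K] *)

Theorem theorem2p1 :
  forall (k : nat) (c nk : R) (K : R -> R),
    (1 <= k)%nat ->
    1 < c < 3 / 2 ->
    (forall x y, 0 <= x -> x <= y -> K x <= K y) ->
    (forall x, 0 <= x -> 0 <= K x) ->
    phiK_integrable K c ->
    exists alpha : R, 0 < alpha /\
      forall (n : nat -> R),
        (forall j, (j < k)%nat -> 1 < n j <= nk) ->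
      forall (A : nat -> Cplx -> Cplx),
        (forall j, (j < k)%nat -> analytic_D (A j)) ->
        (forall j z, (1 <= j < k)%nat -> inD z ->
           Cnorm (A j z) * Rpower (1 - Cnorm z ^ 2) (nk * (INR k - INR j)) <= alpha) ->
        (forall z, inD z ->
           Cnorm (A 0%nat z) * Rpower (1 - Cnorm z ^ 2) (nk * (INR k - c)) <= alpha) ->
      forall (F : nat -> Cplx -> Cplx),
        analytic_D (F 0%nat) -> deriv_chain F ->
      forall (P : nat -> Cplx -> Cplx) (Pk : Cplx -> Cplx),
        (forall j z, (j < k)%nat -> inD z -> rpow_branch (n j) (F j z) (P j z)) ->
        (forall z, inD z -> rpow_branch nk (F k z) (Pk z)) ->
        (forall z, inD z ->
           Cadd (Pk z) (Csum (fun j => Cmul (A j z) (P j z)) k) = C0) ->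
        in_QK K (F 0%nat).
Proof.
intros k c nk K Hk Hc Kmono Kpos Hint.
destruct k as [| m]; [lia |].
(* This is [beta ^ nk] for [beta = / 256], the smallness that [solution_growth] requires. *)
exists (Rpower (/ 256) nk); split; [apply exp_pos |].
intros n Hn A _ HA HA0 F HF0 HF P Pk HP HPk Heq.
destruct (solution_growth F m HF) as [M HM].
{ intros z Hz.
  apply (top_derivative_le m c nk (/ 256) n (fun j => A j z) (fun j => F j z)
    (fun j => P j z) (Pk z) (Cnorm z)); try lra; auto.
  - split; [apply Cnorm_ge0 | exact Hz].
  - intros j Hj; apply Hn; lia.
  - intros j Hj; apply HA; [lia | easy].
  - intros j Hj; apply HP; [lia | easy]. }
destruct (integrand_le K c M (F 1%nat) Hc Kmono Kpos Hint HM) as [C [HC Hh]].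
split; [easy |]; exists (F 1%nat); split; [intros z Hz; apply HF, Hz |].
(* [C] was obtained before [a] is introduced, so the bound is uniform in [a]; the singular line is
   the vertical one through [a]. *)
exists (32 * C / PI); intros a Ha.
apply area_int_le_of_bound with (fst a).
- apply inD_sqr in Ha; assert (Hy := pow2_ge_0 (snd a)); nra.
- easy.
- intros x y Hz Hne; apply Hh; easy.
Qed.
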